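(* The rational function $\mathbf{\Gamma}_T^{(1)}$ determines all double-degree numbers of $T$: if $T,T'$ are trees with $\mathbf{\Gamma}_T^{(1)}=\mathbf{\Gamma}_{T'}^{(1)}$, then $N_{a,b}(T)=N_{a,b}(T')$ for all positive integers $a,b$.
   Context: All graphs are finite and simple. For a tree $T$ and $S\subseteq E(T)$, let $\overline{S}$ be the set of vertices incident to some edge of $S$; define $\mathbf{\Gamma}_T^{(1)}(x,y)=\sum_{S\subseteq E(T),\,|S|=1}\prod_{v\in\overline{S}}\frac{xy^{\deg(v)}}{1+xy^{\deg(v)}}=\sum_{\{v,w\}\in E(T)}\frac{xy^{\deg v}}{1+xy^{\deg v}}\cdot\frac{xy^{\deg w}}{1+xy^{\deg w}}$. The double-degree number $N_{a,b}(T)$ is the number of edges of $T$ whose endpoints have degrees $a$ and $b$ (in $T$). *)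

(* Defs.v *)
From HB Require Import structures.
From mathcomp Require Import all_boot all_order all_algebra.
From mathcomp Require Import fraction mpoly.

Set Implicit Arguments.
Unset Strict Implicit.
Unset Printing Implicit Defensive.

Import GRing.Theory.
Local Open Scope ring_scope.

Record sgraph := SGraph {
  vertex :> finType;
  adj : rel vertex;
  adj_sym : ssrbool.symmetric adj;
  adj_irr : irreflexive adj
}.

Section Graphs.
Variable G : sgraph.

Definition edges : {set {set G}} :=
  [set f : {set G} |
    [exists v : G, exists w : G, adj v w && (f == [set v; w])]].

Definition deg (v : G) : nat := #|[set w : G | adj v w]|.

Definition is_connected : Prop :=
  (0 < #|G|)%N /\ forall v w : G, connect (@adj G) v w.

(* [ucycle] also accepts the sequences [::] and [:: v; w] with v, w adjacent,
   which are not cycles of a simple graph; hence the bound on the size. *)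
Definition is_acyclic : Prop :=
  forall c : seq G, ucycle (@adj G) c -> (size c < 3)%N.

Definition is_tree : Prop := is_connected /\ is_acyclic.

Definition double_degree_number (a b : nat) : nat :=
  #|[set f in edges | [exists v : G, exists w : G,
      [&& f == [set v; w], deg v == a & deg w == b]]]|.

End Graphs.

(* The field Q(x, y). *)
Definition ratfun2 := {fraction {mpoly rat[2]}}.

Definition varx : ratfun2 := tofrac ('X_ord0 : {mpoly rat[2]}).
Definition vary : ratfun2 := tofrac ('X_ord_max : {mpoly rat[2]}).

(* [cover S] is the union of the edges in S, i.e. the set of vertices incident
   to some edge of S. *)
Definition Gamma1 (G : sgraph) : ratfun2 :=
  \sum_(S : {set {set G}} | (S \subset edges G) && (#|S| == 1%N))
    \prod_(v in cover S)
      (varx * vary ^+ deg v / (1 + varx * vary ^+ deg v)).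

Lemma Gamma1_edges (G : sgraph) :
  Gamma1 G = \sum_(f in edges G) \prod_(v in f)
    (varx * vary ^+ deg v / (1 + varx * vary ^+ deg v)).
Proof.
pose F (f : {set G}) := \prod_(v in f)
  (varx * vary ^+ deg v / (1 + varx * vary ^+ deg v)).
have inj1 : {in edges G &, injective (@set1 {set G})}.
  by move=> f g _ _ /set1_inj.
transitivity (\sum_(S in (@set1 {set G}) @: edges G) F (cover S)).
  apply: eq_bigl => S; apply/andP/imsetP => [[sSE /cards1P[f defS]]|[f Ef ->]].
    by exists f => //; move: sSE; rewrite defS sub1set.
  by rewrite sub1set cards1.
by rewrite big_imset //=; apply: eq_bigr => f _; rewrite /cover big_set1.
Qed.

(* Main.v *)
Require Import Defs.
From mathcomp Require Import all_boot all_order all_algebra.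
From mathcomp Require Import fraction mpoly zify ring.

Set Implicit Arguments.
Unset Strict Implicit.
Unset Printing Implicit Defensive.

Import Order.TTheory GRing.Theory Num.Theory.

(** An edge with endpoint degrees [p <= q] contributes
    [\sum_(i, j >= 1) (-1)^(i+j) x^(i+j) y^(p i + q j)] to the expansion of
    [Gamma1] as a power series in [x].  Call [(p, e)] with [e = q - p] its type.
    When [i + j = d + 2], the exponent of [y] is [p (d + 2) + e j].  Hence the
    coefficient of [x^(d+2) y^(a (d+2) + d)] receives no contribution from the
    types lexicographically greater than [(a, d)], and [(-1)^d], from [j = 1],
    for each edge of type [(a, d)].  The coefficients of [Gamma1] thus determine
    the multiset of edge types through a triangular system. *)

Section Triangularity.
Local Open Scope ring_scope.
Variables (disp : Order.disp_t) (T : orderType disp) (R : numDomainType).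
Variable w : T -> T -> R.
Hypothesis w_diag : forall t, w t t != 0.
Hypothesis w_triangular : forall t u, (t < u)%O -> w t u = 0.

Lemma sum_triangularE (s : seq T) t :
  \sum_(u <- s) w t u
  = w t t *+ count_mem t s + \sum_(u <- [seq u <- s | (u < t)%O]) w t u.
Proof.
rewrite big_filter (bigID (< t)%O) /= addrC; congr (_ + _).
rewrite -sum1_count -sumrMnr [LHS]big_mkcond [RHS]big_mkcond /=.
by apply: eq_bigr => u _; case: ltgtP => [||->] //; apply: w_triangular.
Qed.

Lemma perm_eq_triangular (s s' : seq T) :
  (forall t, \sum_(u <- s) w t u = \sum_(u <- s') w t u) -> perm_eq s s'.
Proof.
move=> eq_sums; apply/allP => t _ /=; apply/eqP.
have [n] := ubnP (count (< t)%O (s ++ s')).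
elim: n t => // n IHn t; rewrite ltnS => le_below_n.
have eq_below : perm_eq [seq u <- s | (u < t)%O] [seq u <- s' | (u < t)%O].
  apply/allP => u; rewrite -filter_cat mem_filter => /andP[ltut ssu] /=.
  have count_below r : count_mem u [seq v <- r | (v < t)%O] = count_mem u r.
    by rewrite count_filter; apply: eq_count => v /=; case: eqP => // ->.
  rewrite !count_below IHn //; apply: leq_trans le_below_n.
  rewrite -[leqRHS]size_filter -(count_predC (< u)%O) !count_filter -addn1.
  apply: leq_add.
    by apply/eq_leq/eq_count => v /=; case: ltP => // /lt_trans->.
  by rewrite -has_count; apply/hasP; exists u; rewrite //= ltut ltxx.
move: (eq_sums t); rewrite (sum_triangularE s) (sum_triangularE s').
by rewrite (perm_big _ eq_below) => /addIr /mulrIn; apply.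
Qed.

End Triangularity.

Section Residue.
Local Open Scope ring_scope.
Variables (A : idomainType) (z : A).
Local Notation "c %:F" := (tofrac c).

(* [f] lies in the localization of [A] at [1 + z A], and its residue in
   [A / z A] is the class of [p]. *)
Definition has_residue (f : {fraction A}) (p : A) : Prop :=
  exists s r : A, f * (1 + z * s)%:F = (p + z * r)%:F.

Lemma has_residue_tofrac p : has_residue p%:F p.
Proof. by exists 0, 0; rewrite !mulr0 !addr0 mulr1. Qed.

Lemma has_residueD f g p q :
  has_residue f p -> has_residue g q -> has_residue (f + g) (p + q).
Proof.
move=> [s [r fE]] [t [u gE]]; exists (s + t + z * s * t).
exists (r + u + p * t + q * s + z * (r * t + u * s)).
have -> : 1 + z * (s + t + z * s * t) = (1 + z * s) * (1 + z * t) by ring.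
rewrite tofracM mulrDl mulrA fE mulrCA gE -!tofracM -tofracD.
by congr tofrac; ring.
Qed.

Lemma has_residueM f g p q :
  has_residue f p -> has_residue g q -> has_residue (f * g) (p * q).
Proof.
move=> [s [r fE]] [t [u gE]]; exists (s + t + z * s * t).
exists (p * u + q * r + z * r * u).
have -> : 1 + z * (s + t + z * s * t) = (1 + z * s) * (1 + z * t) by ring.
by rewrite tofracM mulrACA fE gE -tofracM; congr tofrac; ring.
Qed.

Lemma has_residue_sum I (r : seq I) (P : pred I) (f : I -> {fraction A}) p :
  (forall i, P i -> has_residue (f i) (p i)) ->
  has_residue (\sum_(i <- r | P i) f i) (\sum_(i <- r | P i) p i).
Proof.
move=> fp; apply: (big_ind2 has_residue) => //; last first.
  by move=> *; apply: has_residueD.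
by rewrite -tofrac0; apply: has_residue_tofrac.
Qed.

Lemma has_residue_prod I (r : seq I) (P : pred I) (f : I -> {fraction A}) p :
  (forall i, P i -> has_residue (f i) (p i)) ->
  has_residue (\prod_(i <- r | P i) f i) (\prod_(i <- r | P i) p i).
Proof.
move=> fp; apply: (big_ind2 has_residue) => //; last first.
  by move=> *; apply: has_residueM.
by rewrite -tofrac1; apply: has_residue_tofrac.
Qed.

(* If [1 + c = 0], then [z] is invertible and every [p] is a residue of the
   junk value [0^-1 = 0]. *)
Lemma has_residue_geometric (c b : A) n : (- c) ^+ n = z * b ->
  has_residue (1 + c%:F)^-1 (\sum_(k < n) (- c) ^+ k).
Proof.
move=> cn; set S := \sum_(k < n) _.
have denomE : 1 + z * - b = (1 + c) * S.
  by rewrite mulrN -cn -opprB subrX1 -/S; ring.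
have -> : 1 + c%:F = (1 + c)%:F by rewrite tofracD tofrac1.
exists (- b); rewrite denomE; have [c0|c_neq0] := eqVneq (1 + c) 0.
  exists (- b * S); rewrite c0 mul0r tofrac0 mulr0 mulrA -{1}[S]mul1r -mulrDl.
  by rewrite denomE c0 !mul0r tofrac0.
by exists 0; rewrite mulr0 addr0 tofracM mulKf // tofrac_eq0.
Qed.

Lemma has_residue_unique f p q :
  has_residue f p -> has_residue f q -> exists r, p - q = z * r.
Proof.
move=> [s [r pE]] [t [u qE]].
have /eqP : ((p + z * r) * (1 + z * t))%:F = ((q + z * u) * (1 + z * s))%:F.
  by rewrite !tofracM -pE -qE mulrAC.
rewrite tofrac_eq => /eqP pqE.
exists (u - r + (q + z * u) * s - (p + z * r) * t).
transitivity ((p + z * r) * (1 + z * t) - q - z * (r + (p + z * r) * t)).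
  by ring.
by rewrite pqE; ring.
Qed.

End Residue.

Lemma mcoeffXM_eq0 (R : nzRingType) n (m k : 'X_{1..n}) (p : {mpoly R[n]}) :
  ~~ (m <= k)%MM -> (('X_[m] * p)@_k = 0)%R.
Proof.
apply: contraNeq; rewrite -commr_mpolyX -mcoeff_msupp (perm_mem (msuppMX p m)).
by case/mapP => m' _ ->; apply: lem_addr.
Qed.

Definition bimonomial (n m : nat) : 'X_{1..2} :=
  (U_(ord0) *+ n + U_(ord_max) *+ m)%MM.

Lemma bimonomialD n m n' m' :
  (bimonomial n m + bimonomial n' m')%MM = bimonomial (n + n') (m + m').
Proof. by apply/mnmP => i; rewrite !(mnmDE, mulmnE) !mnm1E !mulnDr addnACA. Qed.

Lemma bimonomial_ord0 n m : bimonomial n m ord0 = n.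
Proof. by rewrite mnmDE !mulmnE !mnm1E mul1n mul0n addn0. Qed.

Lemma bimonomial_ord_max n m : bimonomial n m ord_max = m.
Proof. by rewrite mnmDE !mulmnE !mnm1E mul1n mul0n. Qed.

Lemma eq_bimonomial n m n' m' :
  (bimonomial n m == bimonomial n' m') = (n == n') && (m == m').
Proof.
apply/eqP/andP => [eqb|[/eqP-> /eqP->] //].
have := congr1 (fun b : 'X_{1..2} => (b ord0, b ord_max)) eqb.
by rewrite !bimonomial_ord0 !bimonomial_ord_max => -[-> ->].
Qed.

Section VertexSeries.
Local Open Scope ring_scope.
Variable R : comNzRingType.

Lemma mpolyX_bimonomial n m :
  'X_[bimonomial n m] = 'X_ord0 ^+ n * 'X_ord_max ^+ m :> {mpoly R[2]}.
Proof. by rewrite mpolyXD !mpolyXn. Qed.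

(* The terms of degree at most [K] in [x] of the expansion of
   [x y^p / (1 + x y^p)]. *)
Definition vertex_series (K p : nat) : {mpoly R[2]} :=
  \sum_(k < K) (-1) ^+ k *: 'X_[bimonomial k.+1 (p * k.+1)].

Lemma vertex_seriesE K p (c := 'X_ord0 * 'X_ord_max ^+ p) :
  vertex_series K p = c * \sum_(k < K) (- c) ^+ k.
Proof.
rewrite big_distrr; apply: eq_bigr => k _ /=; rewrite mpolyX_bimonomial.
by rewrite -[- c]scaleN1r exprZn -scalerAr -exprS /c exprMn -exprM.
Qed.

Lemma mcoeff_vertex_seriesM K p q n m :
  (vertex_series K p * vertex_series K q)@_(bimonomial n m)
  = \sum_(i < K) \sum_(j < K | (i.+1 + j.+1 == n)
                               && (p * i.+1 + q * j.+1 == m)%N) (-1) ^+ (i + j).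
Proof.
rewrite big_distrl raddf_sum; apply: eq_bigr => i _ /=.
rewrite big_distrr raddf_sum [RHS]big_mkcond; apply: eq_bigr => j _ /=.
rewrite -scalerAl -scalerAr scalerA -exprD -mpolyXD mcoeffZ mcoeffX bimonomialD.
by rewrite eq_bimonomial; case: ifP => _; rewrite ?mulr1 ?mulr0.
Qed.

(* The coefficient of [x^(d+2) y^(a(d+2)+d)] in the contribution of an edge with
   endpoint degrees [p] and [p + e], where [t = (a, d)] and [u = (p, e)]. *)
Definition edge_coef (t u : nat *l nat) : R :=
  (vertex_series t.2.+3 u.1 * vertex_series t.2.+3 (u.1 + u.2))
    @_(bimonomial t.2.+2 (t.1 * t.2.+2 + t.2)).

Lemma edge_coefE t u :
  edge_coef t u
  = \sum_(i < t.2.+3) \sum_(j < t.2.+3 | (i + j == t.2)%N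
      && (u.1 * t.2.+2 + u.2 * j.+1 == t.1 * t.2.+2 + t.2)%N) (-1) ^+ t.2.
Proof.
rewrite /edge_coef mcoeff_vertex_seriesM; apply: eq_bigr => i _.
apply: eq_big => [j|j /andP[/eqP ijd _]]; last by congr (_ ^+ _); lia.
have -> : (i.+1 + j.+1 == t.2.+2) = (i + j == t.2)%N by lia.
by apply: andb_id2l => /eqP ijd; congr (_ == _); nia.
Qed.

Lemma edge_coef_triangular t u : (t < u)%O -> edge_coef t u = 0.
Proof.
case: t u => a d [p e]; rewrite ltxi_pair !leEnat ltEnat /= => lt_ad_pe.
rewrite edge_coefE big1 // => i _; rewrite big_pred0 //= => j.
apply/andP => -[_ /eqP eq_m].
case: (ltngtP a p) lt_ad_pe => //= [lt_ap _|eq_ap lt_de].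
  by have := leq_mul lt_ap (leqnn d.+2); rewrite mulSn; lia.
by move: eq_m; rewrite eq_ap mulnS; nia.
Qed.

Lemma edge_coef_diag t : edge_coef t t = (-1) ^+ t.2.
Proof.
case: t => a d; have ltd : (d < d.+3)%N by rewrite ltnS leqW.
rewrite edge_coefE /= pair_big_dep (big_pred1 (Ordinal ltd, ord0)) //.
move=> [i j] /=; rewrite xpair_eqE -!val_eqE /= eqn_add2l.
move: (i : nat) (j : nat) => {}i {}j; have [->|d_gt0] := posnP d; first by lia.
have -> : (d * j.+1 == d)%N = (j == 0)%N by rewrite -{2}[d]muln1 eqn_pmul2l.
by lia.
Qed.

End VertexSeries.

Definition min_gap (p q : nat) : nat *l nat :=
  (minn p q, maxn p q - minn p q).

Section EdgeTypes.
Variable G : sgraph.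
Implicit Types (v w : G) (f : {set G}).

Definition max_deg f : nat := \max_(v in f) deg v.
Definition min_deg f : nat := \big[Order.min/max_deg f]_(v in f) deg v.
Definition edge_type f : nat *l nat := min_gap (min_deg f) (max_deg f).
Definition edge_types : seq (nat *l nat) := [seq edge_type f | f in edges G].

Lemma max_deg_set2 v w : max_deg [set v; w] = maxn (deg v) (deg w).
Proof. by rewrite /max_deg -maxEnat bigmaxU !bigmax_set1 !maxEnat !maxn0. Qed.

Lemma min_deg_set2 v w : min_deg [set v; w] = minn (deg v) (deg w).
Proof. by rewrite /min_deg max_deg_set2 bigminU !bigmin_set1 !minEnat; lia. Qed.

Lemma edge_type_set2 v w : edge_type [set v; w] = min_gap (deg v) (deg w).
Proof. by rewrite /edge_type min_deg_set2 max_deg_set2; congr pair; lia. Qed.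

Lemma card_edge f : f \in edges G -> #|f| = 2.
Proof.
rewrite inE => /existsP[v /existsP[w /andP[vw /eqP->]]].
by rewrite cards2; case: eqP vw => // ->; rewrite adj_irr.
Qed.

Lemma double_degree_number_count a b :
  double_degree_number G a b = count_mem (min_gap a b) edge_types.
Proof.
rewrite count_map -sum1_count big_enum_cond.
rewrite /double_degree_number -sum1_card; apply: eq_bigl => f; rewrite inE.
apply: andb_id2l => /card_edge/eqP/cards2P[v [w [_ ->]]] /=.
apply/existsP/eqP => [[v' /existsP[w' /and3P[/eqP-> /eqP<- /eqP<-]]]|].
  exact: edge_type_set2.
rewrite edge_type_set2 => -[eq_min eq_gap].
have [da|neq_a] := eqVneq (deg v) a.
  by exists v; apply/existsP; exists w; rewrite eqxx da eqxx; apply/eqP; lia.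
by exists w; apply/existsP; exists v; rewrite setUC eqxx; apply/andP; lia.
Qed.

Lemma prod_edge (R : comPzSemiRingType) (F : nat -> R) f : f \in edges G ->
  (\prod_(v in f) F (deg v)
   = F (edge_type f).1 * F ((edge_type f).1 + (edge_type f).2)%N)%R.
Proof.
move=> /card_edge/eqP/cards2P[v [w [neq_vw ->]]].
rewrite edge_type_set2 big_setU1 ?inE //= big_set1.
by case: leqP => [/subnKC-> // | /ltnW/subnKC->]; rewrite mulrC.
Qed.

End EdgeTypes.

Section GammaSeries.
Local Open Scope ring_scope.

Lemma has_residue_vertex_series K p :
  has_residue ('X_ord0 ^+ K) (varx * vary ^+ p / (1 + varx * vary ^+ p))
    (vertex_series rat K p).
Proof.
rewrite /varx /vary -tofracXn -tofracM vertex_seriesE.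
apply: has_residueM; first exact: has_residue_tofrac.
by apply: has_residue_geometric; rewrite exprNn exprMn mulrCA.
Qed.

Definition Gamma1_series (K : nat) (G : sgraph) : {mpoly rat[2]} :=
  \sum_(f in edges G) \prod_(v in f) vertex_series rat K (deg v).

Lemma has_residue_Gamma1 K G :
  has_residue ('X_ord0 ^+ K) (Gamma1 G) (Gamma1_series K G).
Proof.
rewrite Gamma1_edges; apply: has_residue_sum => f _.
by apply: has_residue_prod => v _; apply: has_residue_vertex_series.
Qed.

Lemma eq_mcoeff_Gamma1_series K G G' n m : Gamma1 G = Gamma1 G' -> (n < K)%N ->
  (Gamma1_series K G)@_(bimonomial n m)
  = (Gamma1_series K G')@_(bimonomial n m).
Proof.
move=> eqG ltnK; have := has_residue_Gamma1 K G'; rewrite -eqG.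
move=> /(has_residue_unique (has_residue_Gamma1 K G)) [r diffE].
apply/eqP; rewrite -subr_eq0 -mcoeffB diffE mpolyXn mcoeffXM_eq0 //.
apply/negP => /mnm_lepP /(_ ord0).
by rewrite mulmnE mnm1E mul1n bimonomial_ord0 leqNgt ltnK.
Qed.

Lemma sum_edge_coef (t : nat *l nat) G :
  \sum_(u <- edge_types G) edge_coef rat t u
  = (Gamma1_series t.2.+3 G)@_(bimonomial t.2.+2 (t.1 * t.2.+2 + t.2)).
Proof.
rewrite big_map big_enum raddf_sum; apply: eq_bigr => f Ef /=.
by rewrite prod_edge.
Qed.

Lemma eq_Gamma1_edge_types G G' :
  Gamma1 G = Gamma1 G' -> perm_eq (edge_types G) (edge_types G').
Proof.
move=> eqG; apply: (perm_eq_triangular (w := edge_coef rat)) => [t|t u|t].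
- by rewrite edge_coef_diag signr_eq0.
- exact: edge_coef_triangular.
by rewrite !sum_edge_coef; apply: eq_mcoeff_Gamma1_series.
Qed.

End GammaSeries.

Theorem theorem4p4 (T T' : sgraph) (hT : is_tree T) (hT' : is_tree T')
    (hG : Gamma1 T = Gamma1 T') (a b : nat) (ha : 0 < a) (hb : 0 < b) :
  double_degree_number T a b = double_degree_number T' a b.
Proof.
rewrite !double_degree_number_count.
exact: permP (eq_Gamma1_edge_types hG) _.
Qed.
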